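(* Let $F$ be a field, let $n,k$ be positive integers and let $m$ be a nonnegative integer. Let $A_1,\ldots,A_n$ be finite nonempty subsets of $F$ with $|A_1|=\cdots=|A_n|=k$, and for each ordered pair $(i,j)$ with $1\leqslant i\neq j\leqslant n$ let $S_{ij}$ be a finite subset of $F$ with $|S_{ij}|=m$. Put $$C=\{a_1+\cdots+a_n:\ a_1\in A_1,\ldots,a_n\in A_n,\ a_i-a_j\notin S_{ij}\ \text{for all } 1\leqslant i\neq j\leqslant n\}.$$ If $p(F)>mn$, then $$|C|\geqslant \min\big\{p(F),\ n(k-1)-mn(n-1)+1\big\}.$$
   Context: For a field $F$, $p(F)$ denotes the additive order of the multiplicative identity of $F$: it is the characteristic of $F$ if that is a prime, and $p(F)=\infty$ (larger than every integer) if $F$ has characteristic zero. $|X|$ denotes the cardinality of a finite set $X$. The sets $S_{ij}$ and $S_{ji}$ are not assumed to be related. *)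

(* Defs.v *)
From HB Require Import structures.
From mathcomp Require Import all_boot all_order all_algebra.
From mathcomp Require Import finmap.
From mathcomp Require Import boolp constructive_ereal.

Set Implicit Arguments.
Unset Strict Implicit.
Unset Printing Implicit Defensive.

Import Order.TTheory GRing.Theory Num.Theory.

Local Open Scope ring_scope.
Local Open Scope fset_scope.

(* The additive order of 1 in F, as an extended integer; the classical case
   split is needed because finiteness of this order is not decidable for an
   arbitrary fieldType. *)
Definition add_order1 (F : fieldType) : \bar int :=
  match pselect (exists p : nat, (0 < p)%N && (p%:R == 0 :> F)) with
  | left e => (Posz (ex_minn e))%:E
  | right _ => +oo%E
  end.

(* S i i is never used. *)
Definition restricted_sumset (F : fieldType) (n : nat) (A : 'I_n -> {fset F})
    (S : 'I_n -> 'I_n -> {fset F}) : {fset F} :=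
  [fset c in [seq \sum_(i < n) val (a i) | a : {dffun forall i : 'I_n, A i} in
     [pred a : {dffun forall i : 'I_n, A i} | [forall i, forall j,
       (i != j) ==> (val (a i) - val (a j) \notin S i j)]]]].

Lemma restricted_sumsetP (F : fieldType) (n : nat) (A : 'I_n -> {fset F})
    (S : 'I_n -> 'I_n -> {fset F}) (c : F) :
  c \in restricted_sumset A S <->
  exists a : 'I_n -> F, [/\ forall i, a i \in A i,
    forall i j, i != j -> a i - a j \notin S i j & c = \sum_(i < n) a i].
Proof.
split.
  rewrite !inE => /imageP[a /forallP aS ->].
  exists (fun i => val (a i)); split=> // [i|i j ij]; first exact: valP.
  by move/forallP: (aS i) => /(_ j)/implyP; apply.
case=> a [aA aS ->]; rewrite !inE; apply/imageP.
pose b : {dffun forall i : 'I_n, A i} := [ffun i => [` aA i]].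
have bE i : val (b i) = a i by rewrite ffunE.
exists b; last by apply: eq_bigr => i _; rewrite bE.
apply/forallP => i; apply/forallP => j.
by apply/implyP => ij; rewrite !bE; exact: aS.
Qed.

Lemma add_order1_pchar (F : fieldType) (p : nat) :
  p \in [pchar F] -> add_order1 F = (Posz p)%:E.
Proof.
move=> pF; have p_pr := pcharf_prime pF.
rewrite /add_order1; case: pselect => [e|[]]; last first.
  by exists p; rewrite prime_gt0 //= pcharf0.
case: ex_minnP => q /andP[q0 qF] qmin; congr ((Posz _)%:E).
apply/eqP; rewrite eqn_leq qmin ?prime_gt0 ?pcharf0 ?eqxx //=.
by rewrite dvdn_leq // (dvdn_pcharf pF).
Qed.

Lemma add_order1_pchar0 (F : fieldType) :
  [pchar F] =i pred0 -> add_order1 F = +oo%E.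
Proof.
move=> F0; rewrite /add_order1; case: pselect => // e; exfalso.
case: e => p /andP[p0]; have /pcharf0P -> := F0; by rewrite eqn0Ngt p0.
Qed.

(* Main.v *)
Require Import Defs.
From HB Require Import structures.
From mathcomp Require Import all_boot all_order all_algebra.
From mathcomp Require Import finmap.
From mathcomp Require Import boolp constructive_ereal.
From mathcomp Require Import zify.


(** The proof is the polynomial method, with the critical coefficient found by
comparing two grids instead of by expanding a polynomial.

Suppose the sumset C had at most M elements. Then the polynomial
  P(x) = prod_(c in C) (x_1 + ... + x_n - c)
         * prod_(i <> j) prod_(s in S_ij) (x_i - x_j - s),
padded with further factors x_1 + ... + x_n up to M of them, vanishes on the
whole product of the A_i. Choose subsets of the A_i of sizes kap_i + 1 with
sum_i kap_i = M + m n (n - 1), the degree of P. The coefficient of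
prod_i x_i ^ kap_i in P is a weighted sum of the values of P over the product
of these subsets (Lagrange interpolation in each variable), so it is zero. But
this coefficient only sees the top homogeneous part of P: the constants c and s
may be replaced by any others, and the subsets by any others of the same sizes
([grid_sum_restriction_poly]).

Replace the i-th subset by the integers 0, ..., kap_i, and choose the constants
so that the new polynomial kills every point of the integer grid but one. With
suitable constants the difference factors leave only integer points whose
coordinates are at least m apart, and even m + 1 apart when their order reverses
that of the indices. Such points have coordinate sum at least
m n (n - 1) / 2, the only one reaching it being (0, m, 2m, ..., (n - 1) m)
([spaced_sum_eq]). If moreover the kap_i decrease slowly, by at most one in total,
then the numbers kap_i - x_i are still m apart, so the coordinate sum is at most
M above that minimum; hence M sum factors suffice to kill all points but the
minimal one ([sparse_model_unique]). There the factors are nonzero integers of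
absolute value at most max(M, m n), which stay nonzero in F as soon as p(F)
exceeds M and m n ([model_poly_witness]). The weighted sum is thus a single
nonzero term, a contradiction, and |C| > M.

For the theorem, M is the minimum of n (k - 1) - m n (n - 1) and p(F) - 1, and
the numbers kap_i - m (n - 1) share M out among the n indices as evenly as
possible ([hermite_sum]). *)

Set Implicit Arguments.
Unset Strict Implicit.
Unset Printing Implicit Defensive.

Import Order.TTheory GRing.Theory Num.Theory.

Local Open Scope ring_scope.
Local Open Scope fset_scope.

(** * Coefficients as weighted sums over a grid *)

Definition lagrange_weight (F : fieldType) (J : finType) (B : {set J})
    (alpha : J -> F) (l : J) : F :=
  (\prod_(l' in B :\ l) (alpha l - alpha l'))^-1.

(** Both sides are the coefficient of degree #|B| - 1 of the polynomial X ^ e: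
the left one is read off its interpolation at the nodes alpha l. *)
Lemma lagrange_moment (F : fieldType) (J : finType) (B : {set J})
    (alpha : J -> F) (e : nat) :
  {in B &, injective alpha} -> (e < #|B|)%N ->
  \sum_(l in B) lagrange_weight B alpha l * alpha l ^+ e
    = (e == #|B|.-1)%:R.
Proof.
move=> inj_alpha ltB.
pose node l : {poly F} := \prod_(l' in B :\ l) ('X - (alpha l')%:P).
pose L : {poly F} :=
  \sum_(l in B) (lagrange_weight B alpha l * alpha l ^+ e) *: node l.
have size_node l : l \in B -> size (node l) = #|B|.
  by move=> lB; rewrite /node -big_enum size_prod_XsubC -cardE (cardsD1 l B) lB.
have nodeE l l' : l \in B -> l' \in B -> l != l' -> (node l).[alpha l'] = 0.
  move=> lB l'B ll'; rewrite /node horner_prod (bigD1 l') /=.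
    by rewrite !hornerE subrr mul0r.
  by rewrite !inE l'B eq_sym ll'.
have LE : L = 'X^e.
  apply/eqP; rewrite -subr_eq0; apply/eqP.
  (* Both polynomials have size at most #|B| and agree at #|B| points. *)
  apply: (@roots_geq_poly_eq0 _ _ [seq alpha l | l in B]).
  - apply/allP=> _ /imageP[l lB ->]; rewrite /root !hornerE ?hornerXn.
    rewrite /L horner_sum (bigD1 l) //= big1 ?addr0 => [|l' /andP[l'B l'l]].
      rewrite hornerZ /node horner_prod /lagrange_weight.
      under [X in _ * X]eq_bigr do rewrite hornerXsubC.
      rewrite mulrAC mulVf ?mul1r ?subrr //.
      apply/prodf_neq0 => l'; rewrite !inE => /andP[l'l l'B].
      rewrite subr_eq0; apply: contra l'l => /eqP eq_a.
      by apply/eqP/inj_alpha.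
    by rewrite hornerZ nodeE ?mulr0.
  - by rewrite map_inj_in_uniq ?enum_uniq // => l l'; rewrite !mem_enum; exact: inj_alpha.
  - rewrite size_map -cardE (leq_trans (size_polyD _ _)) // geq_max.
    rewrite size_polyN size_polyXn ltB andbT (leq_trans (size_sum _ _ _)) //.
    apply/bigmax_leqP => l lB; rewrite (leq_trans (size_scale_leq _ _)) //.
    by rewrite size_node.
have := congr1 (fun q : {poly F} => q`_(#|B|.-1)) LE.
rewrite coefXn eq_sym => <-; rewrite coef_sum; apply: eq_bigr => l lB.
rewrite coefZ; suff -> : (node l)`_(#|B|.-1) = 1 by rewrite mulr1.
rewrite -(size_node l lB) -/(lead_coef _); apply/monicP.
by rewrite /node -big_enum; exact: monic_prod_XsubC.
Qed.

(** The coefficient of prod_v x_v ^ (#|B v| - 1) in a product of affine forms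
of that total degree, as a sum over the grid. The right-hand side mentions
neither the nodes alpha nor the constants c: this is all that the comparison of
two grids needs.

The product is expanded by choosing a term of each form: g t = Some v takes
u t v * x_v, and g t = None takes the constant. By [lagrange_moment] a choice
contributes zero if some v is taken fewer than #|B v| - 1 times; since there are
only as many forms as these numbers add up to, any other choice takes every v
exactly that often and never the constant. *)
Lemma grid_sum_affine (F : fieldType) (V I J : finType) (B : V -> {set J})
    (alpha : V -> J -> F) (u : I -> V -> F) (c : I -> F) :
  (forall v, (0 < #|B v|)%N) -> (forall v, {in B v &, injective (alpha v)}) ->
  #|I| = (\sum_v #|B v|.-1)%N ->
  \sum_(p in family B) (\prod_v lagrange_weight (B v) (alpha v) (p v)) *
      \prod_t (\sum_v u t v * alpha v (p v) - c t)
  = \sum_(g : {ffun I -> option V} |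
        [forall v, #|[set t | g t == Some v]| == #|B v|.-1])
      \prod_t oapp (u t) 0 (g t).
Proof.
move=> B_gt0 inj_alpha cardI.
pose coef t (o : option V) := oapp (u t) (- c t) o.
pose fib (g : {ffun I -> option V}) v := #|[set t | g t == Some v]|.
have expand (p : {ffun V -> J}) : \prod_t (\sum_v u t v * alpha v (p v) - c t) =
    \sum_(g : {ffun I -> option V}) (\prod_t coef t (g t)) *
       \prod_v alpha v (p v) ^+ fib g v.
  pose term t (o : option V) := coef t o * oapp (fun v => alpha v (p v)) 1 o.
  have -> : \prod_t (\sum_v u t v * alpha v (p v) - c t)
          = \prod_t \sum_o term t o.
    apply: eq_bigr => t _; rewrite addrC (bigD1 None) //= {1}/term /= mulr1.
    congr (_ + _)%R; rewrite (reindex_omap Some id) /= => [|[v|] //].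
    by apply: eq_big => // v; rewrite eqxx.
  rewrite bigA_distr_bigA; apply: eq_bigr => g _; rewrite big_split /=.
  congr (_ * _).
  rewrite (partition_big g predT) //= (bigD1 None) //= big1 ?mul1r; last first.
    by move=> t /eqP ->.
  rewrite (reindex_omap Some id) /= => [|[v|] //].
  apply: eq_big => [v|v _]; first by rewrite eqxx.
  rewrite (eq_bigr (fun=> alpha v (p v))) => [|t /eqP -> //].
  by rewrite prodr_const /fib cardsE.
have sum_fib (g : {ffun I -> option V}) :
    (\sum_v fib g v + #|[set t | g t == None]| = #|I|)%N.
  rewrite -[#|I|]sum1_card (partition_big g predT) //= (bigD1 None) //= addnC.
  congr (_ + _)%N; first by rewrite sum1_card cardsE.
  rewrite [RHS](reindex_omap Some id) /= => [|[v|] //].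
  apply: eq_big => [v|v _]; first by rewrite eqxx.
  by rewrite sum1_card /fib cardsE.
under eq_bigr do rewrite expand mulr_sumr.
rewrite exchange_big /= [RHS]big_mkcond /=; apply: eq_bigr => g _.
(* For a fixed choice g, the grid sum factors over the variables. *)
rewrite (_ : \sum_(p in _) _ = (\prod_t coef t (g t)) *
    \prod_v \sum_(l in B v) lagrange_weight (B v) (alpha v) l * alpha v l ^+ fib g v);
  last first.
  rewrite bigA_distr_big_dep mulr_sumr; apply: eq_bigr => p _.
  by rewrite mulrCA -big_split.
case: ifPn => [/forallP fib_eq | ].
  have fibE v : fib g v = #|B v|.-1 by apply/eqP/fib_eq.
  rewrite [X in _ * X]big1 ?mulr1 => [|v _]; last first.
    by rewrite fibE lagrange_moment ?eqxx // prednK.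
  apply: eq_bigr => t _; case gt: (g t) => [v|] //=; exfalso.
  have := sum_fib g; rewrite cardI -(eq_bigr _ (fun v _ => fibE v)).
  move/eqP; rewrite -[X in _ == X]addn0 eqn_add2l cards_eq0 => /eqP/setP/(_ t).
  by rewrite !inE gt eqxx.
move=> not_fib.
have [v lt_v] : exists v, (fib g v < #|B v|.-1)%N.
  apply/existsP; apply: contraR not_fib; rewrite negb_exists => /forallP ge_fib.
  have ge_v v : (#|B v|.-1 <= fib g v)%N by rewrite leqNgt.
  apply/forallP => v; have := sum_fib g; rewrite cardI (bigD1 v) //=.
  rewrite [RHS](bigD1 v) //= => eq_sum; rewrite eqn_leq ge_v andbT -/(fib g v).
  have : (\sum_(w | w != v) #|B w|.-1 <= \sum_(w | w != v) fib g w)%N.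
    by apply: leq_sum.
  lia.
rewrite (bigD1 v) //= lagrange_moment //; last first.
  by apply: leq_trans lt_v _; apply: leq_pred.
by rewrite ltn_eqF // mul0r mulr0.
Qed.

(** * Sums of spaced natural numbers *)

Section Spaced.
Local Open Scope nat_scope.

Definition spaced (T : finType) (m : nat) (x : T -> nat) (B : {set T}) :=
  {in B &, forall i j, i != j -> (x i + m <= x j) || (x j + m <= x i)}.

Lemma spacedD1 (T : finType) m (x : T -> nat) (B : {set T}) i :
  spaced m x B -> spaced m x (B :\ i).
Proof. by move=> spB j l /setD1P[_ jB] /setD1P[_ lB]; apply: spB. Qed.

(** Removing a largest value, the next largest one is at least m lower. The
maximality clause also lets the sums below be treated by removing this value. *)
Lemma spaced_max (T : finType) m (x : T -> nat) (B : {set T}) b :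
  spaced m x B -> #|B| = b.+1 ->
  exists2 i, i \in B & (m * b <= x i) && [forall j in B, x j <= x i].
Proof.
elim: b B => [|b IHb] B spB cardB.
all: have /card_gt0P[i0 i0B] : 0 < #|B| by rewrite cardB.
all: have [i iB imax] := arg_maxnP x i0B.
all: exists i => //; apply/andP; split; last exact/forall_inP.
  by rewrite muln0.
have cardB' : #|B :\ i| = b.+1 by move: cardB; rewrite (cardsD1 i) [i \in B]iB => -[].
have [j /setD1P[ji jB] /andP[le_j _]] := IHb _ (spacedD1 (i := i) spB) cardB'.
have := spB i j iB jB; rewrite eq_sym ji => /(_ isT).
have := imax j jB; nia.
Qed.

Lemma spaced_sum_ge (T : finType) m (x : T -> nat) (B : {set T}) :
  spaced m x B -> m * 'C(#|B|, 2) <= \sum_(i in B) x i.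
Proof.
have [b] := ubnP #|B|; elim: b B => // b IHb B ltB spB.
case cardB: #|B| => [|c]; first by rewrite muln0.
have [i iB /andP[le_i _]] := spaced_max spB cardB.
have cardB' : #|B :\ i| = c by move: cardB; rewrite (cardsD1 i) [i \in B]iB => -[].
rewrite (big_setD1 i) //= binS bin1 mulnDr addnC leq_add //.
by rewrite -cardB'; apply: IHb; [rewrite cardB'; lia | exact: spacedD1].
Qed.

(** Equality in [spaced_sum_ge] forces the values of x on B to be
0, m, 2m, ...; the larger gap required of an inverted pair forces them to come
in the order of the indices, because neighbouring values differ by exactly m.
When m = 0 inversions are not excluded by gaps, but then all values are 0. *)
Lemma spaced_sum_eq (n m : nat) (x : 'I_n -> nat) (B : {set 'I_n}) :
  {in B &, forall i j : 'I_n, i < j -> (x i + m <= x j) || (x j + m < x i)} ->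
  \sum_(i in B) x i <= m * 'C(#|B|, 2) ->
  {in B, forall i : 'I_n, x i = m * #|[set j in B | j < i]|}.
Proof.
have [->|m_gt0] := posnP m.
  move=> _; rewrite mul0n leqn0 sum_nat_eq0 => /forall_inP x0 i iB.
  by rewrite mul0n; apply/eqP/x0.
have [b] := ubnP #|B|; elim: b B => // b IHb B ltB gap sumB.
have spB : spaced m x B.
  move=> i j iB jB; rewrite neq_ltn =>
    /orP[/(gap i j iB jB)|/(gap j i jB iB)] /orP[] ?; apply/orP; lia.
case cardB: #|B| => [|c].
  by move=> i; rewrite (cards0_eq cardB) inE.
have [i iB /andP[le_i /forall_inP imax]] := spaced_max spB cardB.
have cardB' : #|B :\ i| = c by move: cardB; rewrite (cardsD1 i) [i \in B]iB => -[].
have sumB'_ge := spaced_sum_ge (spacedD1 (i := i) spB).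
move: sumB; rewrite (big_setD1 i) //= cardB binS bin1 mulnDr => sumB.
rewrite cardB' in sumB'_ge.
set s := \sum_(_ in _) x _ in sumB'_ge sumB *.
have xi : x i = m * c by lia.
have gap' : {in B :\ i &, forall j l : 'I_n, j < l -> (x j + m <= x l) || (x l + m < x j)}.
  by move=> j l /setD1P[_ jB] /setD1P[_ lB]; exact: gap.
have rank' : {in B :\ i, forall j : 'I_n, x j = m * #|[set l in B :\ i | l < j]|}.
  apply: IHb => //; rewrite cardB'; first by rewrite -ltnS -cardB.
  by rewrite -/s; clearbody s; lia.
(* The largest value sits at the largest index i: otherwise the largest index j
   of the rest, which carries the value m * (c - 1) by induction, would form an
   inverted pair with i at distance only m. *)
have lt_i : {in B :\ i, forall j : 'I_n, j < i}.
  move=> j0 j0B'; rewrite ltnNge; apply/negP => le_ij0.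
  have [j jB' jmax] := arg_maxnP (fun j : 'I_n => j : nat) j0B'.
  have /setD1P[ji jB] := jB'.
  have lt_ij : i < j.
    rewrite ltn_neqAle (leq_trans le_ij0 (jmax _ j0B')) andbT.
    by apply: contra ji => /eqP/val_inj->.
  have rank_j : #|[set l in B :\ i | l < j]| = c.-1.
    rewrite -cardB' [#|B :\ i|](cardsD1 j) [j \in _]jB' /=; apply: eq_card => l; rewrite !inE.
    have [->|lj] := eqVneq l j; first by rewrite ltnn andbF.
    case lB': ((l != i) && (l \in B)) => //=; rewrite ltn_neqAle.
    apply/andP; split; last by apply: jmax; apply/setD1P; apply/andP.
    by apply: contra lj => /eqP/val_inj->.
  have := rank' j jB'; rewrite rank_j => xj.
  have c_gt0 : 0 < c by rewrite -cardB' (cardsD1 j) [j \in _]jB'.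
  have cE : m * c = m * c.-1 + m by rewrite -{1}(prednK c_gt0) mulnS addnC.
  by have /orP[] := gap i j iB jB lt_ij; have := imax j jB; lia.
move=> j jB; have [->|ji] := eqVneq j i.
  rewrite xi -cardB'; congr (_ * _); apply: eq_card => l; rewrite !inE.
  have [->|li] := eqVneq l i; first by rewrite ltnn andbF.
  by case lB: (l \in B) => //=; rewrite lt_i // !inE li.
have jB' : j \in B :\ i by rewrite !inE ji.
rewrite rank' //; congr (_ * _); apply: eq_card => l; rewrite !inE.
have [->|//] := eqVneq l i.
by rewrite ltnNge ltnW ?andbF // lt_i.
Qed.

End Spaced.

(** * The polynomial of a restricted sumset *)

Definition offdiag (n : nat) := {q : 'I_n * 'I_n | q.1 != q.2}.

Lemma card_offdiag (n : nat) : #|{: offdiag n}| = (n * n.-1)%N.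
Proof.
rewrite card_sig -sum1_card -(pair_big_dep predT (fun i j : 'I_n => i != j) (fun _ _ => 1%N)) /=.
rewrite (eq_bigr (fun=> n.-1)) ?sum_nat_const ?card_ord // => i _.
rewrite sum1_card -[in RHS](card_ord n) -(cardC1 i).
by apply: eq_card => j; rewrite !inE eq_sym.
Qed.

(** The numbers M and m of factors are fixed by the index types of c and s, so
that lists of values shorter than M can be padded without changing the degree. *)
Definition restriction_poly (F : fieldType) (n M m : nat) (c : 'I_M -> F)
    (s : 'I_n -> 'I_n -> 'I_m -> F) (x : 'I_n -> F) : F :=
  (\prod_t (\sum_i x i - c t)) *
  \prod_(q : offdiag n) \prod_l
     (x (val q).1 - x (val q).2 - s (val q).1 (val q).2 l).

Lemma grid_sum_restriction_poly (F : fieldType) (n M m : nat) (J : finType)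
    (B : 'I_n -> {set J}) (alpha beta : 'I_n -> J -> F) (c d : 'I_M -> F)
    (s r : 'I_n -> 'I_n -> 'I_m -> F) :
  (forall i, (0 < #|B i|)%N) ->
  (forall i, {in B i &, injective (alpha i)}) ->
  (forall i, {in B i &, injective (beta i)}) ->
  (\sum_i #|B i|.-1 = M + m * (n * n.-1))%N ->
  \sum_(p in family B) (\prod_i lagrange_weight (B i) (alpha i) (p i)) *
      restriction_poly c s (fun i => alpha i (p i))
  = \sum_(p in family B) (\prod_i lagrange_weight (B i) (beta i) (p i)) *
      restriction_poly d r (fun i => beta i (p i)).
Proof.
move=> B_gt0 inj_alpha inj_beta sumB.
pose I := ('I_M + offdiag n * 'I_m)%type.
pose u (t : I) (v : 'I_n) : F :=
  if t is inr (q, _) then (v == (val q).1)%:R - (v == (val q).2)%:R else 1.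
pose cst (c0 : 'I_M -> F) (s0 : 'I_n -> 'I_n -> 'I_m -> F) (t : I) : F :=
  match t with inl t0 => c0 t0 | inr (q, l) => s0 (val q).1 (val q).2 l end.
have cardI : #|{: I}| = (\sum_i #|B i|.-1)%N.
  by rewrite sumB card_sum card_prod !card_ord card_offdiag [(m * _)%N]mulnC.
have polyE c0 s0 (x : 'I_n -> F) :
    restriction_poly c0 s0 x = \prod_(t : I) (\sum_v u t v * x v - cst c0 s0 t).
  rewrite big_sumType /=; congr (_ * _)%R.
    by apply: eq_bigr => t _; congr (_ - _)%R; apply: eq_bigr => v _; rewrite mul1r.
  rewrite pair_big /=; apply: eq_bigr => -[q l] _ /=; congr (_ - _)%R.
  have pick (i : 'I_n) : \sum_v (v == i)%:R * x v = x i.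
    by rewrite (bigD1 i) //= eqxx mul1r big1 ?addr0 // => v /negPf->; rewrite mul0r.
  by under eq_bigr do rewrite mulrBl; rewrite sumrB !pick.
under eq_bigr do rewrite polyE.
under [RHS]eq_bigr do rewrite polyE.
by rewrite !grid_sum_affine.
Qed.

(** The constants are listed as the elements of the sumset and of the S i j;
beyond the end of the sumset the default 0 serves as padding. *)
Lemma restriction_poly_vanishes (F : fieldType) (n m M : nat)
    (A : 'I_n -> {fset F}) (S : 'I_n -> 'I_n -> {fset F}) (x : 'I_n -> F) :
  (forall i j, i != j -> #|` S i j| = m) ->
  (#|` restricted_sumset A S| <= M)%N -> (forall i, x i \in A i) ->
  restriction_poly (fun t : 'I_M => nth 0 (restricted_sumset A S) t)
    (fun i j (l : 'I_m) => nth 0 (S i j) l) x = 0.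
Proof.
move=> cardS leC xA; apply/eqP; rewrite mulf_eq0.
case: (boolP [exists q : offdiag n, x (val q).1 - x (val q).2 \in S (val q).1 (val q).2]).
  case/existsP=> q qS; apply/orP; right; apply/prodf_eq0; exists q => //.
  have idx : (index (x (val q).1 - x (val q).2)%R (S (val q).1 (val q).2) < m)%N.
    by rewrite -(cardS _ _ (valP q)) index_mem.
  apply/prodf_eq0; exists (Ordinal idx) => //=.
  by rewrite nth_index // subrr.
rewrite negb_exists => /forallP xS; apply/orP; left.
have xC : \sum_i x i \in restricted_sumset A S.
  apply/restricted_sumsetP; exists x; split=> // i j ij.
  exact: (xS (exist _ (i, j) ij)).
have idx : (index (\sum_i x i)%R (restricted_sumset A S) < M)%N.
  by apply: leq_trans leC; rewrite index_mem.
by apply/prodf_eq0; exists (Ordinal idx) => //=; rewrite nth_index // subrr.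
Qed.

(** * The integer grid *)

(** The complements kap i - y i are again m apart: the gap of an inverted pair
of y exceeds m by one, which pays for the one unit that kap may lose between the
two indices. Bounding both sums from below by m * 'C(n, 2) thus confines the sum
of y to an interval of length M, of which the last hypothesis leaves only the
lower end. *)
Lemma sparse_model_unique (n m M : nat) (kap y : 'I_n -> nat) :
  (forall i j : 'I_n, (i < j)%N -> (kap j <= kap i <= (kap j).+1)%N) ->
  (\sum_i kap i = M + m * (n * n.-1))%N ->
  (forall i, y i <= kap i)%N ->
  (forall i j : 'I_n, (i < j)%N -> (y i + m <= y j) || (y j + m < y i))%N ->
  ~~ (m * 'C(n, 2) < \sum_i y i <= m * 'C(n, 2) + M)%N ->
  forall i, y i = (m * i)%N.
Proof.
move=> kap_step sum_kap y_le gap not_mid i.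
have binE : (n * n.-1 = 'C(n, 2) * 2)%N.
  by rewrite -[2%N]/(2`!)%N bin_ffact ffactnS ffactn1.
have sum_z : (m * 'C(n, 2) <= \sum_i (kap i - y i))%N.
  have spz : spaced m (fun i => kap i - y i)%N [set: 'I_n].
    move=> j l _ _; rewrite neq_ltn => /orP[] lt_jl;
    have := kap_step _ _ lt_jl; have := gap _ _ lt_jl;
    have := y_le j; have := y_le l; lia.
  have := spaced_sum_ge spz; rewrite cardsT card_ord.
  by under eq_bigl do rewrite inE.
have sum_yz : (\sum_i y i + \sum_i (kap i - y i) = \sum_i kap i)%N.
  by rewrite -big_split; apply: eq_bigr => j _; rewrite /= subnKC.
have y_min : (\sum_(i in [set: 'I_n]) y i <= m * 'C(#|[set: 'I_n]|, 2))%N.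
  rewrite cardsT card_ord; under eq_bigl do rewrite inE.
  rewrite binE in sum_kap; move: not_mid; rewrite negb_and -!ltnNge ltnS => /orP[//|]; lia.
rewrite (spaced_sum_eq _ y_min) ?inE //; last by move=> j l _ _; apply: gap.
congr (_ * _)%N; rewrite -[RHS](card_ord i).
have lt_in (j : 'I_i) : (j < n)%N by apply: ltn_trans (ltn_ord j) (ltn_ord i).
pose f (j : 'I_i) := Ordinal (lt_in j).
rewrite -(card_imset predT (f := f)) => [|j l /(congr1 val) /= /val_inj //].
apply: eq_card => j; rewrite !inE; apply/idP/imsetP => [lt_ji|[l _ ->]].
  by exists (Ordinal lt_ji) => //; apply: val_inj.
by rewrite /= ltn_ord.
Qed.

Lemma natr_inj_small (F : fieldType) (q a b : nat) :
  (forall j, (0 < j < q)%N -> j%:R != 0 :> F) ->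
  (a < q)%N -> (b < q)%N -> a%:R = b%:R :> F -> a = b.
Proof.
move=> small; wlog le_ab : a b / (a <= b)%N.
  by move=> wl aq bq e; case: (leqP a b) => [|/ltnW] le; [|symmetry]; apply: wl.
move=> _ bq e; apply/eqP; rewrite eqn_leq le_ab leqNgt; apply/negP => lt_ab.
have /small/eqP[] : (0 < b - a < q)%N by rewrite subn_gt0 lt_ab (leq_ltn_trans (leq_subr _ _)).
by rewrite natrB // e subrr.
Qed.

(** Sum constants for the integer grid: the M values just above the least sum
m * 'C(n, 2) of a spaced point. *)
Definition model_sum (F : fieldType) (n m M : nat) (t : 'I_M) : F :=
  (m * 'C(n, 2) + t.+1)%:R.

(** Difference constants for the integer grid: for i < j, the factors indexed by
(i, j) exclude x i - x j = 1, ..., m, and those indexed by (j, i) exclude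
x j - x i = 0, ..., m - 1. *)
Definition model_diff (F : fieldType) (n m : nat) (i j : 'I_n) (l : 'I_m) : F :=
  (l + (i < j))%:R.

Lemma model_poly_support (F : fieldType) (n m M : nat) (kap y : 'I_n -> nat) :
  (forall i j : 'I_n, (i < j)%N -> (kap j <= kap i <= (kap j).+1)%N) ->
  (\sum_i kap i = M + m * (n * n.-1))%N ->
  (forall i, y i <= kap i)%N ->
  restriction_poly (@model_sum F n m M) (@model_diff F n m) (fun i => (y i)%:R) != 0 ->
  forall i, y i = (m * i)%N.
Proof.
move=> kap_step sum_kap y_le; rewrite mulf_eq0 negb_or => /andP[sumN0 diffN0].
have diff_neq (i j : 'I_n) l : i != j -> (l < m)%N -> (y i != y j + (l + (i < j)))%N.
  move=> ij lm; apply: contraNN diffN0 => /eqP yE.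
  apply/prodf_eq0; exists (exist _ (i, j) ij) => //.
  apply/prodf_eq0; exists (Ordinal lm) => //=.
  by rewrite yE /model_diff /= [in X in X - _ - _]natrD addrAC addrK subrr.
apply: (sparse_model_unique kap_step sum_kap y_le) => [i j ij|].
  have ij' : i != j by rewrite neq_ltn ij.
  have nji : (j < i)%N = false by rewrite ltnNge (ltnW ij).
  apply/orP; case: (leqP (y i) (y j)) => cmp; [left|right]; rewrite leqNgt; apply/negP=> lt.
    have := diff_neq j i (y j - y i)%N; rewrite eq_sym ij' nji /=; lia.
  have := diff_neq i j (y i - (y j).+1)%N ij'; rewrite ij /=; lia.
apply: contraNN sumN0 => /andP[lo hi].
have lt_M : (\sum_i y i - (m * 'C(n, 2)).+1 < M)%N by lia.
apply/prodf_eq0; exists (Ordinal lt_M) => //=.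
rewrite /model_sum /= -natr_sum -subSn // subSS subnKC ?subrr //; exact: ltnW.
Qed.

(** At x i = m * i the sum factors are -1, ..., -M and the difference factors
compare two natural numbers that are distinct and at most m * n. *)
Lemma model_poly_witness (F : fieldType) (q n m M : nat) :
  (forall j, (0 < j < q)%N -> j%:R != 0 :> F) -> (M < q)%N -> (m * n < q)%N ->
  restriction_poly (@model_sum F n m M) (@model_diff F n m)
    (fun i => (m * i)%:R) != 0.
Proof.
move=> small ltM ltmn; rewrite mulf_neq0 //.
  apply/prodf_neq0 => t _; rewrite -natr_sum -big_distrr /=.
  rewrite -(big_mkord xpredT id) bin2_sum /model_sum natrD opprD addrA subrr add0r oppr_eq0.
  by apply: small; rewrite /= (leq_ltn_trans (ltn_ord t)).
apply/prodf_neq0 => -[[i j] /= ij] _; apply/prodf_neq0 => l _; rewrite /model_diff.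
have lm := ltn_ord l; have ltin := ltn_ord i; have ltjn := ltn_ord j.
rewrite subr_eq0 subr_eq -natrD; apply/eqP.
move=> /(natr_inj_small small _ _) => /(_ ltac:(nia) ltac:(nia)).
by move: ij; rewrite neq_ltn; case: ltngtP => //= lt_ij _; nia.
Qed.

(** * Lower bounds for the restricted sumset *)

(** The two evaluations of the critical coefficient contradict each other if the
sumset has at most M elements: over the grid of the A i every term vanishes, over
the integer grid exactly one does not. *)
Lemma card_restricted_sumset_gt (F : fieldType) (q n m M k : nat)
    (kap : 'I_n -> nat) (A : 'I_n -> {fset F}) (S : 'I_n -> 'I_n -> {fset F}) :
  (forall j, (0 < j < q)%N -> j%:R != 0 :> F) -> (M < q)%N -> (m * n < q)%N ->
  (forall i, kap i < q)%N -> (forall i, kap i < k)%N ->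
  (forall i, m * n.-1 <= kap i)%N ->
  (forall i j : 'I_n, (i < j)%N -> (kap j <= kap i <= (kap j).+1)%N) ->
  (\sum_i kap i = M + m * (n * n.-1))%N ->
  (forall i, #|` A i| = k) -> (forall i j, i != j -> #|` S i j| = m) ->
  (M < #|` restricted_sumset A S|)%N.
Proof.
move=> small ltM ltmn kap_q kap_k kap_ge kap_step sum_kap cardA cardS.
rewrite ltnNge; apply/negP => leC.
pose B i := [set l : 'I_k | (l <= kap i)%N].
have cardB i : #|B i| = (kap i).+1.
  have le_k := kap_k i.
  pose f (a : 'I_(kap i).+1) : 'I_k := widen_ord le_k a.
  rewrite -[RHS]card_ord -(card_imset predT (f := f)); last first.
    by move=> a b /(congr1 val) /= /val_inj.
  apply: eq_card => l; rewrite !inE; apply/idP/imsetP => [le_l|[a _ ->]].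
    by exists (Ordinal (le_l : (l < (kap i).+1)%N)) => //; apply: val_inj.
  by rewrite /= -ltnS ltn_ord.
pose alpha i (l : 'I_k) := nth 0 (A i) l.
pose beta (_ : 'I_n) (l : 'I_k) : F := l%:R.
have B_gt0 i : (0 < #|B i|)%N by rewrite cardB.
have inj_alpha i : {in B i &, injective (alpha i)}.
  move=> l l' _ _ /eqP; rewrite nth_uniq ?cardA ?fset_uniq // => /eqP.
  exact: val_inj.
have inj_beta i : {in B i &, injective (beta i)}.
  move=> l l'; rewrite !inE => lB l'B e.
  apply/val_inj/(natr_inj_small small _ _ e).
    exact: leq_ltn_trans lB _.
  exact: leq_ltn_trans l'B _.
have sumB : (\sum_i #|B i|.-1 = M + m * (n * n.-1))%N.
  by rewrite -sum_kap; apply: eq_bigr => i _; rewrite cardB.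
have := grid_sum_restriction_poly
  (fun t => nth 0 (restricted_sumset A S) t) (@model_sum F n m M)
  (fun i j l => nth 0 (S i j) l) (@model_diff F n m) B_gt0 inj_alpha inj_beta sumB.
rewrite big1 => [|p _]; last first.
  rewrite (@restriction_poly_vanishes _ _ m M) ?mulr0 // => i.
  by rewrite mem_nth // cardA.
have lt_top (i : 'I_n) : (m * i < k)%N.
  apply: leq_ltn_trans (kap_k i); apply: leq_trans (kap_ge i).
  by rewrite leq_mul2l -ltnS prednK ?ltn_ord ?orbT // (leq_ltn_trans _ (ltn_ord i)).
pose p0 : {ffun 'I_n -> 'I_k} := [ffun i => Ordinal (lt_top i)].
have p0B : p0 \in family B.
  apply/familyP=> i; rewrite ffunE inE /=; apply: leq_trans (kap_ge i).
  by rewrite leq_mul2l -ltnS prednK ?ltn_ord ?orbT // (leq_ltn_trans _ (ltn_ord i)).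
rewrite (bigD1 p0) //= [X in (_ + X)%R]big1 ?addr0 => [|p /andP[/familyP pB pp0]]; last first.
  apply/eqP; rewrite mulf_eq0; apply/orP; right; apply: contraNT pp0 => nz.
  apply/eqP/ffunP => i; rewrite ffunE; apply: val_inj => /=.
  apply: (model_poly_support kap_step sum_kap _ nz) => j.
  by have := pB j; rewrite inE.
move/esym/eqP; rewrite mulf_eq0 => /orP[|].
  apply/negP; apply/prodf_neq0 => i _; rewrite invr_eq0.
  apply/prodf_neq0 => l; rewrite !inE => /andP[lp lB].
  rewrite subr_eq0; apply: contra lp => /eqP e.
  apply/eqP/val_inj/esym; apply: (natr_inj_small small _ _ e).
    by have /familyP/(_ i) := p0B; rewrite inE => /leq_ltn_trans; apply.
  exact: leq_ltn_trans lB _.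
apply/negP.
have -> : (fun i => beta i (p0 i)) = (fun i : 'I_n => (m * i)%:R).
  by apply/funext => i; rewrite /beta ffunE.
exact: model_poly_witness small ltM ltmn.
Qed.

(** Hermite's identity for floors: the shares (M + n - 1 - i) / n are
an even partition of M into n parts. Raising M by one
shifts the summation window, replacing the floor of M / n by that of
(M + n) / n. *)
Lemma hermite_sum (n M : nat) : (0 < n)%N ->
  (\sum_(i < n) (M + n.-1 - i) %/ n = M)%N.
Proof.
move=> n_gt0.
have -> : (\sum_(i < n) (M + n.-1 - i) %/ n = \sum_(i < n) (M + i) %/ n)%N.
  rewrite (reindex_inj rev_ord_inj) /=; apply: eq_bigr => i _.
  congr (_ %/ _)%N; have := ltn_ord i; lia.
elim: M => [|M IHM].
  by rewrite big1 // => i _; rewrite add0n divn_small.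
(* The shifted and the original sum are the two ways of splitting one end term
   off this sum over n + 1 indices. *)
have stp : (\sum_(i < n.+1) (M + i) %/ n = \sum_(i < n) (M + i) %/ n + (M + n) %/ n)%N.
  by rewrite big_ord_recr.
move: stp; rewrite big_ord_recl /= IHM (divnDr _ (dvdnn n)) divnn n_gt0 addn0.
under eq_bigr do rewrite /bump /= addnA addn1.
lia.
Qed.

(** The even shares of M, raised by m * (n - 1), are at most any b with
n * b at least M + m n (n - 1). Taking b = k - 1 they fit into the A i; taking
b = q - 1, which qualifies because M and m * n are at most q - 1, the integers
0, ..., kap i are distinct in F. *)
Lemma card_restricted_sumset_bound (F : fieldType) (q n m M k : nat)
    (A : 'I_n -> {fset F}) (S : 'I_n -> 'I_n -> {fset F}) :
  (forall j, (0 < j < q)%N -> j%:R != 0 :> F) -> (0 < n)%N ->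
  (M < q)%N -> (m * n < q)%N -> (M + m * (n * n.-1) <= n * k.-1)%N -> (0 < k)%N ->
  (forall i, #|` A i| = k) -> (forall i j, i != j -> #|` S i j| = m) ->
  (M < #|` restricted_sumset A S|)%N.
Proof.
move=> small n_gt0 ltM ltmn le_M k_gt0 cardA cardS.
pose kap (i : 'I_n) := ((M + n.-1 - i) %/ n + m * n.-1)%N.
have kap_le (i : 'I_n) b : (M + m * (n * n.-1) <= n * b)%N -> (kap i <= b)%N.
  move=> le_b; have : ((M + n.-1 - i) %/ n <= b - m * n.-1)%N.
    rewrite -ltnS ltn_divLR //; nia.
  have : (m * n.-1 <= b)%N by nia.
  rewrite /kap; lia.
apply: (@card_restricted_sumset_gt F q n m M k kap) => //.
- move=> i; rewrite -(ltn_predK ltM) ltnS; apply: kap_le; nia.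
- move=> i; rewrite -(ltn_predK k_gt0) ltnS; exact: kap_le.
- by move=> i; apply: leq_addl.
- move=> i j ij; rewrite /kap; have := ltn_ord j => ltj.
  have e1 : ((M + n.-1 - j) %/ n <= (M + n.-1 - i) %/ n)%N by apply: leq_div2r; lia.
  have e2 : ((M + n.-1 - i) %/ n <= (M + n.-1 - j + n) %/ n)%N by apply: leq_div2r; lia.
  move: e2; rewrite (divnDr _ (dvdnn n)) divnn n_gt0; lia.
- by rewrite big_split /= hermite_sum // sum_nat_const card_ord; congr (_ + _)%N; lia.
Qed.

Theorem theorem1p3 (F : fieldType) (n k m : nat) (A : 'I_n -> {fset F})
    (S : 'I_n -> 'I_n -> {fset F}) :
  (0 < n)%N -> (0 < k)%N ->
  (forall i, #|` A i| = k) ->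
  (forall i j, i != j -> #|` S i j| = m) ->
  ((Posz (m * n)%N)%:E < add_order1 F)%E ->
  (Order.min (add_order1 F)
     (n%:Z * (k%:Z - 1) - m%:Z * n%:Z * (n%:Z - 1) + 1)%:E
   <= (Posz #|` restricted_sumset A S|)%:E)%E.
Proof.
move=> n_gt0 k_gt0 cardA cardS.
set N : int := (n%:Z * (k%:Z - 1) - m%:Z * n%:Z * (n%:Z - 1))%R.
have NE : N = (n * k.-1)%N%:Z - (m * (n * n.-1))%N%:Z.
  rewrite /N !PoszM mulrA; congr (_ * _ - _ * _)%R; lia.
have bound q M : (forall j, (0 < j < q)%N -> j%:R != 0 :> F) ->
    (m * n < q)%N -> (M < q)%N -> (M%:Z <= N)%R ->
    (M < #|` restricted_sumset A S|)%N.
  move=> small ltmn ltM leM; apply: (@card_restricted_sumset_bound F q n m M k) => //.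
  by move: leM; rewrite NE lerBrDr -PoszD lez_nat.
have [N_lt0|N_ge0] := ltP N 0.
  move=> _; rewrite ge_min lee_fin; apply/orP; right; lia.
rewrite /add_order1; case: pselect => [e|char0]; last first.
  move=> _; rewrite ge_min lee_fin; apply/orP; right.
  have small j q : (0 < j < q)%N -> j%:R != 0 :> F.
    by case/andP=> j_gt0 _; apply/negP => j0; apply: char0; exists j; rewrite j_gt0.
  have := bound (m * n + `|N| + 1)%N `|N|%N (fun j => small j _); lia.
case: ex_minnP => q /andP[q_gt0 _] q_min; rewrite lte_fin => ltmn.
have small j : (0 < j < q)%N -> j%:R != 0 :> F.
  case/andP=> j_gt0; rewrite ltnNge => ltjq; apply: contra ltjq => j0.
  by apply: q_min; rewrite j_gt0.
rewrite ge_min !lee_fin.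
have := bound q (minn `|N| q.-1) small; lia.
Qed.
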